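(* Let $G$ be a $2$-tree of order $n\ge 3$. Then the following statements are equivalent: (a) $G$ has a perfect $3$-cover; (b) $G$ belongs to the family $\mathcal E$; (c) $G$ is $\alpha$-excellent.
   Context: All graphs are finite and simple. A $2$-tree is a graph obtainable from $K_2$ by finitely many applications of the operation: add a new vertex and join it to both ends of an existing edge. A triangle is a set of three mutually adjacent vertices $a,b,c$, written $abc$. A perfect $3$-cover of $G$ is a set of triangles of $G$ such that every vertex of $G$ lies in exactly one of them. $\alpha(G)$ is the independence number; an $\alpha$-set is an independent set of size $\alpha(G)$; $G$ is $\alpha$-excellent if every vertex lies in some $\alpha$-set. The family $\mathcal E$ consists of $2$-trees $G$ in which every triangle carries a label $R$ (red) or $B$ (blue); $R(G)$ and $B(G)$ denote the sets of red and blue triangles. It is defined recursively: (1) the $2$-tree of order $3$ whose only triangle is red belongs to $\mathcal E$; (2) $\mathcal E$ is closed under the operations $\mathcal O_1,\mathcal O_2$: - $\mathcal O_1(v_1,v_2)$: for $G'\in\mathcal E$ and an edge $v_1v_2$ of $G'$, add three new vertices $u_1,u_2,u_3$ so that $v_1v_2u_1$, $v_2u_1u_2$, $u_1u_2u_3$ are new triangles (i.e. $u_1$ adjacent to $v_1,v_2$; $u_2$ adjacent to $v_2,u_1$; $u_3$ adjacent to $u_1,u_2$), with $R(G)=R(G')\cup\{u_1u_2u_3\}$ and $B(G)=B(G')\cup\{v_1v_2u_1,v_2u_1u_2\}$. - $\mathcal O_2(v_1v_2,v_3v_4)$: for $G'\in\mathcal E$, a red triangle $v_1v_2v_3\in R(G')$,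 and a neighbor $v_4$ of $v_3$ in $G'$ (possibly $v_4\in\{v_1,v_2\}$), add three new vertices $u_0,u_1,u_2$ so that $u_0v_1v_2$, $v_3v_4u_1$, $v_3u_1u_2$ are new triangles, with $R(G)=(R(G')\setminus\{v_1v_2v_3\})\cup\{u_0v_1v_2, v_3u_1u_2\}$ and $B(G)=B(G')\cup\{v_1v_2v_3, v_3v_4u_1\}$. A (unlabeled) $2$-tree belongs to $\mathcal E$ if it is the underlying graph of some member of $\mathcal E$. *)

(* Defs.v *)
From mathcomp Require Import all_boot.

Set Implicit Arguments.
Unset Strict Implicit.
Unset Printing Implicit Defensive.

(** Graphs live in an ambient finite type [T]: the vertex set is a subset of
    [T], and an edge is a two-element set of vertices.  Recursive constructions
    then draw their new vertices from [T], so no explicit closure under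
    isomorphism is needed: a construction sequence for a graph isomorphic to
    [G] can be renamed into one that uses the vertices of [G]. *)
Record sgraph (T : finType) := SGraph {
  vset : {set T};
  eset : {set {set T}};
  esetP : eset \subset [set e : {set T} | (e \subset vset) && (#|e| == 2)]
}.

Section Graphs.
Variable T : finType.
Implicit Types (G : sgraph T) (S t : {set T}).

Definition adj G (x y : T) : bool := [set x; y] \in eset G.

Inductive two_tree : sgraph T -> Prop :=
| two_tree_K2 G x y :
    x != y ->
    vset G = [set x; y] ->
    eset G = [set [set x; y]] ->
    two_tree G
| two_tree_add G' G x y u :
    two_tree G' ->
    adj G' x y ->
    u \notin vset G' ->
    vset G = u |: vset G' ->
    eset G = eset G' :|: [set [set u; x]; [set u; y]] ->
    two_tree G.

Definition triangles G : {set {set T}} :=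
  [set t : {set T} | [&& t \subset vset G, #|t| == 3 &
    [forall x in t, forall y in t, (x != y) ==> adj G x y]]].

Definition perfect_3cover G (C : {set {set T}}) : Prop :=
  C \subset triangles G /\
  forall x, x \in vset G -> exists! t, t \in C /\ x \in t.

Definition independent G S : bool :=
  (S \subset vset G) && [forall x in S, forall y in S, ~~ adj G x y].

Definition alpha G : nat := \max_(S : {set T} | independent G S) #|S|.

Definition alpha_set G S : bool := independent G S && (#|S| == alpha G).

Definition alpha_excellent G : Prop :=
  forall x, x \in vset G -> exists2 S, alpha_set G S & x \in S.

(** [labeled_E G R B]: the graph [G] with red triangles [R] and blue triangles
    [B] is a labeled member of the family.  In [labeled_E_O2] the vertex [v4]
    may be [v1] or [v2]. *)
Inductive labeled_E : sgraph T -> {set {set T}} -> {set {set T}} -> Prop :=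
| labeled_E_base G a b c :
    uniq [:: a; b; c] ->
    vset G = [set a; b; c] ->
    eset G = [set [set a; b]; [set b; c]; [set a; c]] ->
    labeled_E G [set [set a; b; c]] set0
| labeled_E_O1 G' R' B' G v1 v2 u1 u2 u3 :
    labeled_E G' R' B' ->
    adj G' v1 v2 ->
    uniq [:: u1; u2; u3] ->
    u1 \notin vset G' -> u2 \notin vset G' -> u3 \notin vset G' ->
    vset G = vset G' :|: [set u1; u2; u3] ->
    eset G = eset G' :|: [set [set u1; v1]; [set u1; v2];
                              [set u2; v2]; [set u2; u1];
                              [set u3; u1]; [set u3; u2]] ->
    labeled_E G
      (R' :|: [set [set u1; u2; u3]])
      (B' :|: [set [set v1; v2; u1]; [set v2; u1; u2]])
| labeled_E_O2 G' R' B' G v1 v2 v3 v4 u0 u1 u2 :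
    labeled_E G' R' B' ->
    [set v1; v2; v3] \in R' ->
    adj G' v3 v4 ->
    uniq [:: u0; u1; u2] ->
    u0 \notin vset G' -> u1 \notin vset G' -> u2 \notin vset G' ->
    vset G = vset G' :|: [set u0; u1; u2] ->
    eset G = eset G' :|: [set [set u0; v1]; [set u0; v2];
                              [set u1; v3]; [set u1; v4];
                              [set u2; v3]; [set u2; u1]] ->
    labeled_E G
      ((R' :\ [set v1; v2; v3]) :|: [set [set u0; v1; v2]; [set v3; u1; u2]])
      (B' :|: [set [set v1; v2; v3]; [set v3; v4; u1]]).

Definition in_family_E G : Prop := exists R B, labeled_E G R B.

End Graphs.

(* Main.v *)
Require Import Defs.
From mathcomp Require Import all_boot zify.

(** The vertices of a 2-tree split into three colour classes meeting every
    triangle once, so a perfect 3-cover with [k] triangles forces [alpha = k]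
    and every colour class is an alpha-set.  Conversely, eliminating vertices
    in reverse construction order yields a partition of the vertices into
    [alpha] cliques, which every alpha-set must meet.  A clique other than a
    triangle has a common neighbour [z], and an alpha-set through [z] would
    miss it; so in an alpha-excellent 2-tree the partition is a perfect
    3-cover.

    The red triangles of a member of the family form a perfect 3-cover.  For
    the converse, order the vertices by a construction of the 2-tree.  Going
    backwards, each vertex has nothing hanging below it, or exactly one vertex
    of degree two, or else one of the two operations can be undone so that the
    cover remains perfect. *)

Set Implicit Arguments.
Unset Strict Implicit.
Unset Printing Implicit Defensive.

Section TwoTrees.
Variable T : finType.
Implicit Types (G : sgraph T) (S t q A U : {set T}) (C Q : {set {set T}}).

(** * Edges, triangles and covers *)

Lemma eq_set2 (x y u v : T) :
  ([set x; y] == [set u; v]) =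
  ((x == u) && (y == v)) || ((x == v) && (y == u)).
Proof.
apply/eqP/idP => [E | /orP[] /andP[/eqP-> /eqP->] //]; last exact: setUC.
have hx : x \in [set u; v] by rewrite -E set21.
have hy : y \in [set u; v] by rewrite -E set22.
have hu : u \in [set x; y] by rewrite E set21.
have hv : v \in [set x; y] by rewrite E set22.
move: hx hy hu hv; rewrite !inE.
by do 4![case/orP=> /eqP ?]; subst; rewrite ?eqxx ?orbT.
Qed.

Lemma adjC G x y : adj G x y = adj G y x.
Proof. by rewrite /adj setUC. Qed.

Lemma adj_vset G x y : adj G x y -> [/\ x \in vset G, y \in vset G & x != y].
Proof.
move/(subsetP (esetP G)); rewrite inE subUset !sub1set cards2.
by case/andP => /andP[-> ->]; case: (x == y).
Qed.

Lemma adj_neq G x y : adj G x y -> x != y.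
Proof. by case/adj_vset. Qed.

Lemma edge_ends G e : e \in eset G -> exists x y, e = [set x; y].
Proof.
move/(subsetP (esetP G)); rewrite inE => /andP[_ /cards2P[x [y]]] [_ ->].
by exists x, y.
Qed.

Lemma eset_ext G (E : {set {set T}}) :
  (forall e, e \in E -> exists x y, e = [set x; y]) ->
  (forall x y, adj G x y = ([set x; y] \in E)) -> eset G = E.
Proof.
move=> HE adjE; apply/setP => e; apply/idP/idP => He.
  by have [x [y def_e]] := edge_ends He; rewrite def_e -adjE /adj -def_e.
by have [x [y def_e]] := HE _ He; move: (adjE x y); rewrite /adj -def_e He.
Qed.

Lemma triangle_at G t x : t \in triangles G -> x \in t ->
  exists y z, [/\ t = [set x; y; z], adj G x y, adj G x z & adj G y z].
Proof.
rewrite inE => /and3P[_ /eqP ct tadj] xt.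
have ad u v : u \in t -> v \in t -> u != v -> adj G u v.
  move=> ut vt; apply/implyP; move: v vt; apply/forall_inP.
  exact: (forall_inP tadj).
have /cards2P[y [z [yz tE]]] : #|t :\ x| == 2.
  by move: ct; rewrite (cardsD1 x) xt add1n => -[->].
have /setD1P[yx yt] : y \in t :\ x by rewrite tE !inE eqxx.
have /setD1P[zx zt] : z \in t :\ x by rewrite tE !inE eqxx orbT.
exists y, z; split; try by apply: ad; rewrite // eq_sym.
by rewrite -(setD1K xt) tE setUA.
Qed.

Lemma triangle_mem G x y z :
  adj G x y -> adj G x z -> adj G y z -> [set x; y; z] \in triangles G.
Proof.
move=> xy xz yz; case: (adj_vset xy) (adj_vset xz) (adj_vset yz).
move=> Vx Vy nxy [_ Vz nxz] [_ _ nyz]; rewrite inE; apply/and3P; split.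
- by rewrite !subUset !sub1set Vx Vy Vz.
- by rewrite -setUA cardsU1 !inE negb_or nxy nxz cards2 nyz.
- apply/forall_inP => u; rewrite !inE -orbA => Hu.
  apply/forall_inP => v; rewrite !inE -orbA => Hv.
  by apply/implyP; case/or3P: Hu => /eqP->; case/or3P: Hv => /eqP->;
     rewrite ?eqxx //= 1?adjC.
Qed.

Lemma set3_rot (x y z : T) : [set x; y; z] = [set y; z; x].
Proof. by rewrite -setUA setUC. Qed.

Lemma set3_swap (x y z : T) : [set x; y; z] = [set y; x; z].
Proof. by rewrite (setUC [set x]). Qed.

Lemma perfect_3coverP G C : perfect_3cover G C <->
  [/\ C \subset triangles G,
      (forall x, x \in vset G -> exists2 t, t \in C & x \in t) &
      (forall x t t', t \in C -> t' \in C -> x \in t -> x \in t' -> t = t')].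
Proof.
split=> [[CT CV]|[CT CE CU]]; split=> // x.
- by case/CV => t [[tC xt] _]; exists t.
- move=> t t' tC t'C xt xt'.
  have Vx : x \in vset G.
    by move/(subsetP CT): tC; rewrite inE => /andP[/subsetP-> //].
  by have [s [_ sU]] := CV x Vx; rewrite -(sU t) // (sU t').
- by case/CE => t tC xt; exists t; split=> // t' [t'C]; apply: CU.
Qed.

Lemma adj_add G G' u x y z w :
  eset G = eset G' :|: [set [set u; x]; [set u; y]] ->
  adj G z w = [|| adj G' z w, (z == u) && ((w == x) || (w == y))
                | (w == u) && ((z == x) || (z == y))].
Proof.
rewrite {1}/adj => ->; rewrite !inE !eq_set2 -/(adj G' z w).
by case: (z == u); case: (w == u); case: (z == x); case: (w == x);
   case: (z == y); case: (w == y); rewrite ?orbT ?orbF.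
Qed.

Lemma two_tree_ext G G' : vset G = vset G' -> eset G = eset G' ->
  two_tree G -> two_tree G'.
Proof.
move=> EV EE H; case: H EV EE.
  by move=> {}G x y xy -> -> EV EE; apply: (two_tree_K2 xy).
move=> H {}G x y u tH xy uH -> -> EV EE.
exact: (two_tree_add tH xy uH (esym EV) (esym EE)).
Qed.

(** * Vertex deletion in 2-trees *)

Fact del_subproof G U :
  [set e in eset G | [disjoint e & U]] \subset
    [set e : {set T} | (e \subset vset G :\: U) && (#|e| == 2)].
Proof.
apply/subsetP => e; rewrite inE => /andP[/(subsetP (esetP G))].
by rewrite !inE subsetD => /andP[-> ->] ->.
Qed.

Definition del G U : sgraph T := SGraph (del_subproof G U).

Lemma adj_del G U x y :
  adj (del G U) x y = [&& adj G x y, x \notin U & y \notin U].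
Proof.
rewrite {1}/adj /= inE -/(adj G x y); congr (_ && _).
by rewrite disjoints_subset subUset !sub1set !inE.
Qed.

Lemma del_del G U U' : two_tree (del (del G U) U') -> two_tree (del G (U :|: U')).
Proof.
apply: two_tree_ext => /=; first by rewrite setDDl.
apply/setP => e; rewrite !inE -andbA; congr (_ && _).
by rewrite -!setI_eq0 setIUr setU_eq0.
Qed.

(** Serves [two_tree_del]: a vertex with at most two neighbours in the whole graph already has both
    of them before the last vertex is added, so the last vertex is not adjacent to it. *)
Lemma two_tree_two_neighbours G : two_tree G -> 3 <= #|vset G| ->
  forall u, u \in vset G ->
    exists x y, [/\ adj G u x, adj G u y & x != y].
Proof.
elim=> [{}G x y xy -> _|G' {}G x y u G't IH xy uG' EV EE] .
  by rewrite cards2 xy.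
move=> _ v; have A := adj_add _ _ EE; have [Vx Vy nxy] := adj_vset xy.
rewrite EV !inE => /orP[/eqP->|Vv].
  by exists x, y; rewrite !A !eqxx ?orbT.
case: (leqP 3 #|vset G'|) => [/IH/(_ v Vv)[z [z' [vz vz' zz']]]|V2].
  by exists z, z'; rewrite !A vz vz'.
have VE : vset G' = [set x; y].
  apply/esym/eqP; rewrite eqEcard subUset !sub1set Vx Vy cards2 nxy.
  by rewrite -ltnS.
move: Vv; rewrite VE !inE => /orP[]/eqP->.
  exists y, u; rewrite !A xy !eqxx ?orbT; split=> //.
  by apply: contraNneq uG' => <-.
exists x, u; rewrite !A adjC xy !eqxx ?orbT; split=> //.
by apply: contraNneq uG' => <-.
Qed.

(** Any vertex of degree two can be taken as the last one of a construction. If [u] is older than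
    the last vertex [v], then [u] is not an end of the edge [a b] carrying [v], so deleting [u]
    commutes with adding [v]. The exception is a triangle, where [G'] is a single edge. *)
Lemma two_tree_del G u x y : two_tree G -> 3 <= #|vset G| ->
  u \in vset G -> (forall z, adj G u z -> z = x \/ z = y) ->
  two_tree (del G [set u]).
Proof.
move=> Gt; elim: Gt u x y => [{}G a b ab -> _|G' {}G a b v G't IH ab vG' EV EE].
  by rewrite cards2 ab.
move=> u x y _; have A := adj_add _ _ EE; have [Va Vb nab] := adj_vset ab.
rewrite EV in_setU1; case: (eqVneq u v) => [-> _ _|uv /= Vu Nu].
  apply: two_tree_ext G't => /=; rewrite ?EV.
    by rewrite setU1K.
  rewrite EE; apply/setP => e; rewrite !inE.
  have [eG'|] /= := boolP (e \in eset G').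
    have := subsetP (esetP G') _ eG'; rewrite inE => /andP[/subsetP eV _].
    by rewrite disjoint_sym disjoints1; apply/esym/negP => /eV; apply/negP.
  move=> _; apply/esym/negbTE; rewrite negb_and disjoint_sym disjoints1 negbK.
  by rewrite -implybE; apply/implyP => /orP[]/eqP->; rewrite !inE eqxx.
have nva : a != v by apply: contraNneq vG' => <-.
have nvb : b != v by apply: contraNneq vG' => <-.
case: (leqP 3 #|vset G'|) => [V3|V2]; last first.
  have VE : vset G' = [set a; b].
    apply/esym/eqP; rewrite eqEcard subUset !sub1set Va Vb cards2 nab.
    by rewrite -ltnS.
  (* Here [G] is the triangle [v c d]; deleting [u = d] leaves the edge [v c]. *)
  have K c d : adj G' c d -> vset G' = [set c; d] -> u = d ->
      two_tree (del G [set u]).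
    move=> cd E Ed; have [Vc Vd ncd] := adj_vset cd.
    have ad : adj G v c.
      by move: Vc; rewrite A VE !inE eqxx => /orP[]->; rewrite /= ?orbT.
    apply: (@two_tree_K2 _ _ v c) => //=; first by rewrite (adj_neq ad).
      rewrite EV E Ed; apply/setP => z; rewrite !inE.
      case: (eqVneq z v) => [->|_]; first by rewrite -Ed eq_sym uv.
      case: (eqVneq z c) => [->|_]; first by rewrite ncd.
      by case: (z == d).
    apply: (@eset_ext (del G [set u])) => [e|z w].
      by rewrite inE => /eqP->; exists v, c.
    rewrite adj_del !inE eq_set2; apply/idP/idP.
      case/and3P => /adj_vset[]; rewrite EV E !inE Ed => + + + nz nw.
      rewrite (negbTE nz) (negbTE nw) !orbF.
      by move=> /orP[]/eqP-> /orP[]/eqP->; rewrite ?eqxx ?orbT.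
    by case/orP=> /andP[/eqP-> /eqP->];
      rewrite ?(adjC _ c) ad Ed ?ncd ?(eq_sym v) -?Ed ?uv //.
  move: (Vu); rewrite VE !inE => /orP[]/eqP E.
    by apply: (K b a); rewrite 1?adjC // VE setUC.
  exact: (K a b).
have Nu' z : adj G' u z -> z = x \/ z = y by move=> uz; apply: Nu; rewrite A uz.
have [z [z' [uz uz' zz']]] := two_tree_two_neighbours G't V3 Vu.
(* Two distinct neighbours of [u] in [G'] already exhaust [x] and [y], so [v] is neither of them. *)
have vxy : v != x /\ v != y.
  have vz : v != z by apply: contraNneq vG' => ->; case: (adj_vset uz).
  have vz' : v != z' by apply: contraNneq vG' => ->; case: (adj_vset uz').
  move: zz'; case: (Nu' _ uz) => E; case: (Nu' _ uz') => E';
    by rewrite -?E -?E' ?vz ?vz' // E E' eqxx.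
have nuab : u != a /\ u != b.
  by split; apply/eqP => E; case: vxy; case: (Nu v); rewrite ?A ?E ?eqxx ?orbT //;
    move=> ->; rewrite ?eqxx.
case: nuab => nua nub.
apply: (@two_tree_add _ (del G' [set u]) _ a b v) => //=.
- exact: IH Nu'.
- by rewrite adj_del ab !inE !(eq_sym _ u) nua nub.
- by rewrite !inE negb_and vG' orbT.
- by rewrite EV; apply/setP => w; rewrite !inE;
  case: (eqVneq w v) => [->|] //; rewrite eq_sym uv.
apply/setP => e; rewrite EE !inE.
case: (eqVneq e [set v; a]) => [->|_].
  by rewrite ?orbT disjoint_sym disjoints1 !inE negb_or uv nua.
case: (eqVneq e [set v; b]) => [->|_].
  by rewrite ?orbT disjoint_sym disjoints1 !inE negb_or uv nub.
by rewrite !orbF.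
Qed.

(** * Independent sets, colourings and clique partitions *)

Definition clique G q := {in q &, forall x y, x != y -> adj G x y}.

Lemma independentP G S : reflect
  (S \subset vset G /\ {in S &, forall x y, ~~ adj G x y}) (independent G S).
Proof.
apply: (iffP andP) => -[SV indS]; split=> //.
  by move=> x y xS yS; move/forall_inP/(_ x xS)/forall_inP: indS; apply.
by apply/forall_inP => x xS; apply/forall_inP => y yS; apply: indS.
Qed.

Lemma independent_card_alpha G S : independent G S -> #|S| <= alpha G.
Proof. exact: leq_bigmax_cond. Qed.

Lemma card_partition_meet Q A S : partition Q A -> S \subset A ->
  #|S| = \sum_(q in Q) #|S :&: q|.
Proof.
move=> pQ SA; have -> : #|S| = \sum_(x in A) (x \in S).
  by rewrite -sum1_card big_mkcond /= [RHS]big_mkcond /=; apply: eq_bigr => x _;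
     case: (boolP (x \in S)) => [/(subsetP SA) ->|_] //; rewrite if_same.
rewrite (set_partition_big _ pQ) /=; apply: eq_bigr => q _.
rewrite -sum1_card big_mkcond [RHS]big_mkcond /=; apply: eq_bigr => x _.
by rewrite inE; case: (x \in q); rewrite ?andbF ?andbT //; case: (x \in S).
Qed.

Lemma independent_meet_clique G S q :
  independent G S -> clique G q -> #|S :&: q| <= 1.
Proof.
case/independentP => _ indS clq; apply/card_le1P => x /setIP[xS xq] y.
rewrite !inE; apply/andP/eqP => [[yS yq]|->//]; apply/eqP.
by apply: contraTT (indS y x yS xS) => nyx; rewrite negbK clq.
Qed.

Lemma triangle_clique G t : t \in triangles G -> clique G t.
Proof.
rewrite inE => /and3P[_ _ tadj] x y xt yt.
by apply/implyP; move: y yt; apply/forall_inP; apply: (forall_inP tadj).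
Qed.

Lemma perfect_3cover_partitionP G C :
  perfect_3cover G C <-> C \subset triangles G /\ partition C (vset G).
Proof.
split=> [/perfect_3coverP[CT CE CU]|[CT pC]].
  split=> //; apply/and3P; split.
  - rewrite eqEsubset; apply/andP; split.
      by apply/bigcupsP => t /(subsetP CT); rewrite inE => /andP[].
    by apply/subsetP => x /CE[t tC xt]; apply/bigcupP; exists t.
  - apply/trivIsetP => t t' tC t'C; apply: contraNT.
    by case/pred0Pn => x /andP[xt xt']; apply/eqP; apply: (CU x).
  - by apply/negP => /(subsetP CT); rewrite inE cards0 andbF.
apply/perfect_3coverP; split=> // [x|x t t' tQ t'Q xt xt'].
  by rewrite -(cover_partition pC) => /bigcupP[t tC xt]; exists t.
have tI := partition_trivIset pC.
by rewrite -(def_pblock tI tQ xt) (def_pblock tI t'Q xt').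
Qed.

Lemma two_tree_3colouring G : two_tree G ->
  exists f : T -> 'I_3, forall x y, adj G x y -> f x != f y.
Proof.
elim=> [{}G x y xy _ EE|G' {}G x y u _ [f Hf] xy uG' _ EE].
  exists (fun z => if z == x then inord 0 else inord 1) => z w.
  rewrite /adj EE inE eq_set2 => /orP[]/andP[/eqP-> /eqP->];
    rewrite eqxx (eq_sym y) (negbTE xy) -val_eqE /= !inordK //.
(* The new vertex sees only [x] and [y], so one of the three colours is free. *)
have [c [cx cy]] : exists c : 'I_3, c != f x /\ c != f y.
  have /card_gt0P[c] : 0 < #|~: [set f x; f y]|.
    by have := cardsC [set f x; f y]; rewrite card_ord cards2; lia.
  by rewrite !inE negb_or => /andP[? ?]; exists c.
have [Vx Vy _] := adj_vset xy.
have nu z : z \in vset G' -> (z == u) = false.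
  by move=> Vz; apply/negbTE; apply: contraNneq uG' => <-.
exists (fun z => if z == u then c else f z) => z w; rewrite (adj_add _ _ EE).
case/or3P => [zw|/andP[/eqP-> /orP[]/eqP->]|/andP[/eqP-> /orP[]/eqP->]].
- by have [Vz Vw _] := adj_vset zw; rewrite !nu // Hf.
- by rewrite eqxx nu.
- by rewrite eqxx nu.
- by rewrite eqxx nu // eq_sym.
- by rewrite eqxx nu // eq_sym.
Qed.

Lemma perfect_3cover_alpha_excellent G C :
  two_tree G -> perfect_3cover G C -> alpha_excellent G.
Proof.
move=> Gt /perfect_3cover_partitionP[CT pC].
have [f fP] := two_tree_3colouring Gt.
have le_alpha S : independent G S -> #|S| <= #|C|.
  move=> indS; case/independentP: (indS) => SV _.
  rewrite (card_partition_meet pC SV) -sum1_card; apply: leq_sum => t tC.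
  by apply: independent_meet_clique indS (triangle_clique (subsetP CT _ tC)).
have colour_class i : let S := [set x in vset G | f x == i] in
    independent G S /\ #|S| = #|C|.
  move=> S; have indS : independent G S.
    apply/independentP; split; first by apply/subsetP => x; rewrite inE => /andP[].
    move=> x y; rewrite !inE => /andP[_ /eqP fx] /andP[_ /eqP fy].
    by apply/negP => /fP; rewrite fx fy eqxx.
  split=> //; apply/eqP; rewrite eqn_leq le_alpha //=.
  case/independentP: (indS) => SV _.
  rewrite (card_partition_meet pC SV) -sum1_card; apply: leq_sum => t tC.
  have tT := subsetP CT _ tC.
  (* A proper colouring is injective on a triangle, hence hits all three colours there; so every
     colour class meets every triangle of the cover. *)
  have finj : {in t &, injective f}.
    move=> x y xt yt E; apply/eqP; apply: contra_eqT E => nxy.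
    by apply: fP; apply: (triangle_clique tT).
  have /imsetP[x xt fx] : i \in f @: t.
    suff -> : f @: t = setT by rewrite inE.
    apply/eqP; rewrite eqEcard subsetT cardsT card_ord card_in_imset //.
    by move: tT; rewrite inE => /and3P[_ /eqP-> _].
  apply/card_gt0P; exists x; rewrite !inE fx eqxx xt !andbT.
  by move: tT; rewrite inE => /and3P[/subsetP-> //].
have alphaE : alpha G = #|C|.
  apply/eqP; rewrite eqn_leq; apply/andP; split; first by apply/bigmax_leqP.
  by have [indS <-] := colour_class ord0; apply: independent_card_alpha.
move=> x Vx; exists [set y in vset G | f y == f x]; last by rewrite inE Vx eqxx.
by have [indS cS] := colour_class (f x); rewrite /alpha_set indS alphaE cS eqxx.
Qed.

(* Greedy elimination: the last vertex [u] of the construction has a clique as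
   its closed neighbourhood, so [u] joins the independent set and the trace of
   that clique on [A] becomes a new block. *)
Lemma two_tree_clique_partition G : two_tree G -> forall A, A \subset vset G ->
  exists S Q, [/\ independent G S, S \subset A, partition Q A,
                  {in Q, forall q, clique G q} & #|S| = #|Q|].
Proof.
(* If [A] lies inside one clique, a single block and a single vertex suffice. The size of [S] is
   constrained only for nonempty [A], because the empty set gets the empty partition. *)
have base (H : sgraph T) A S q : S \subset A -> A \subset q -> clique H q ->
    A \subset vset H -> (A != set0 -> #|S| = 1) ->
  exists S Q, [/\ independent H S, S \subset A, partition Q A,
                  {in Q, forall q, clique H q} & #|S| = #|Q|].
  move=> SA Aq clq AV cS; have [->|A0] := eqVneq A set0.
    exists set0, set0; split; rewrite ?cards0 ?sub0set //.
    - by apply/independentP; split=> [|x]; rewrite ?sub0set ?inE.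
    - by rewrite partition_set0.
    - by move=> t; rewrite inE.
  exists S, [set A]; split=> //; last by rewrite cards1 cS.
  - apply/independentP; split; first exact: subset_trans AV.
    have /cards1P[s ->] : #|S| == 1 by rewrite cS.
    by move=> x y /set1P-> /set1P->; apply/negP => /adj_neq; rewrite eqxx.
  - apply/and3P; split; rewrite ?inE 1?eq_sym //.
      by rewrite /cover big_set1.
    exact: trivIset1.
  - by move=> t /set1P-> x y xA yA; apply: clq; apply: (subsetP Aq).
elim=> [{}G x y xy EV EE|G' {}G x y u _ IH xy uG' EV EE] A AV.
  have clV : clique G (vset G).
    rewrite EV => z w /set2P[]-> /set2P[]->; rewrite ?eqxx // /adj EE inE //.
    by rewrite setUC.
  have [->|[z zA]] := set_0Vmem A.
    by apply: (@base _ _ set0 (vset G)); rewrite ?sub0set ?eqxx.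
  by apply: (@base _ _ [set z] (vset G)) => //; rewrite ?sub1set ?cards1.
have A' := adj_add _ _ EE; have [Vx Vy _] := adj_vset xy.
have adjG z w : z \in vset G' -> w \in vset G' -> adj G z w = adj G' z w.
  move=> Vz Vw; rewrite A'; have [zu|_] := eqVneq z u; first by rewrite -zu Vz in uG'.
  by have [wu|_] := eqVneq w u; [rewrite -wu Vw in uG'|rewrite !orbF].
have step (B : {set T}) : B \subset vset G' -> exists S Q,
    [/\ independent G S, S \subset B, partition Q B, {in Q, forall q, clique G q} & #|S| = #|Q|].
  move=> BV; have [S [Q [/independentP[SV indS] SB pQ clQ cS]]] := IH B BV.
  exists S, Q; split=> //.
    apply/independentP; split; first by rewrite EV (subset_trans SV) ?subsetUr.
    by move=> z w zS wS; rewrite adjG ?indS // (subsetP SV).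
  by move=> q qQ z w zq wq zw; rewrite A' (clQ q qQ z w).
have [uA|uA] := boolP (u \in A); last first.
  apply: step; apply/subsetP => z zA; move: (subsetP AV z zA).
  by rewrite EV !inE => /orP[/eqP zu|//]; rewrite zu (negbTE uA) in zA.
(* [N] is the closed neighbourhood of [u]. The induction hypothesis is applied to [A] without [N],
   so the set it returns contains no neighbour of [u]. *)
pose N := [set u; x; y].
have [|S [Q [/independentP[SV indS] SB pQ clQ cS]]] := step (A :\: N).
  apply/subsetP => z; rewrite !inE => /andP[+ /(subsetP AV)]; rewrite EV !inE.
  by case: (z == u).
have uS : u \notin S by apply/negP => /(subsetP SB); rewrite !inE eqxx.
have NA0 : N :&: A != set0 by apply/set0Pn; exists u; rewrite !inE eqxx.
have NAQ : N :&: A \notin Q.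
  apply: contra NA0 => NAQ; rewrite -subset0; apply/subsetP => z zNA.
  have : z \in A :\: N by rewrite -(cover_partition pQ); apply/bigcupP; exists (N :&: A).
  by move: zNA; rewrite !inE => /andP[-> _].
exists (u |: S), (N :&: A |: Q); split.
- apply/independentP; split.
    by rewrite subUset sub1set (subsetP AV) ?SV.
  have uSn z : z \in S -> ~~ adj G u z.
    move=> /(subsetP SB); rewrite !inE -orbA => /andP[zN zA]; apply/negP => uz.
    have := adj_neq uz; move: uz zN; rewrite A' eqxx.
    case/or3P => [/adj_vset[]|/=->|/andP[->]]; rewrite ?orbT //.
    by rewrite (negbTE uG').
  move=> z w /setU1P[->|zS] /setU1P[->|wS].
  + by apply/negP => /adj_neq; rewrite eqxx.
  + exact: uSn.
  + by rewrite adjC uSn.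
  + exact: indS.
- by rewrite subUset sub1set uA (subset_trans SB) ?subsetDl.
- rewrite -[A in partition _ A](setID A N) (setIC A N); apply: partitionU1 => //.
  by rewrite -setI_eq0; apply/eqP/setP => z; rewrite !inE; case: (_ || _); rewrite ?andbF.
- move=> q /setU1P[->|/clQ//] z w /setIP[+ _] /setIP[+ _]; rewrite !inE -!orbA A'.
  by case/or3P=> /eqP->; case/or3P=> /eqP->; rewrite ?eqxx ?xy ?orbT // adjC xy.
- by rewrite !cardsU1 uS NAQ cS.
Qed.

(** A clique through the last vertex [u] lies in the triangle [u x y]; if it misses [x] or [y], that
    missing vertex is the common neighbour. A clique avoiding [u] is handled by induction, except
    that when [G'] is just the edge [x y] the common neighbour is [u] itself. *)
Lemma clique_extension G q : two_tree G -> 3 <= #|vset G| ->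
  q \subset vset G -> clique G q -> q \in triangles G \/
  exists z, [/\ z \in vset G, z \notin q & {in q, forall x, adj G z x}].
Proof.
move=> Gt; elim: Gt q => [{}G x y xy -> _|G' {}G x y u _ IH xy uG' EV EE] q.
  by rewrite cards2 xy.
move=> _ qV clq; have A' := adj_add _ _ EE; have [Vx Vy nxy] := adj_vset xy.
have [uq|uq] := boolP (u \in q).
  have qN z : z \in q -> z \in [set u; x; y].
    move=> zq; rewrite !inE; have [//|zu] := eqVneq z u.
    have := clq z u zq uq zu; rewrite A' eqxx (negbTE zu) /= => /orP[|//].
    by case/adj_vset; rewrite (negbTE uG').
  have ext a b : [set a; b] = [set x; y] -> a \notin q ->
      exists z, [/\ z \in vset G, z \notin q & {in q, forall x, adj G z x}].
    move=> ab aq; exists a.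
    have /set2P a_xy : a \in [set x; y] by rewrite -ab set21.
    split=> //; first by rewrite EV !inE; case: a_xy => ->; rewrite ?Vx ?Vy orbT.
    move=> z zq; have := qN z zq; rewrite -setUA -ab !inE => /or3P[]/eqP zE.
    - by rewrite zE A' eqxx; case: a_xy => ->; rewrite ?eqxx ?orbT.
    - by rewrite -zE zq in aq.
    by rewrite zE /adj ab -/(adj G x y) A' xy.
  have [xq|xq] := boolP (x \in q); last by right; apply: (ext x y).
  have [yq|yq] := boolP (y \in q); last by right; apply: (ext y x) => //; rewrite setUC.
  left; have -> : q = [set u; x; y].
    apply/eqP; rewrite eqEsubset !subUset !sub1set uq xq yq !andbT.
    by apply/subsetP.
  by apply: triangle_mem; rewrite A' ?eqxx ?xy ?orbT.
have qV' : q \subset vset G'.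
  apply/subsetP => z zq; move: (subsetP qV z zq).
  by rewrite EV !inE => /orP[/eqP zu|//]; rewrite zu (negbTE uq) in zq.
have [V3|V2] := leqP 3 #|vset G'|; last first.
  right; exists u; split=> //; first by rewrite EV setU11.
  have VE : [set x; y] = vset G'.
    by apply/eqP; rewrite eqEcard subUset !sub1set Vx Vy cards2 nxy -ltnS.
  move=> z /(subsetP qV'); rewrite A' eqxx -VE !inE => ->.
  by rewrite orbT.
have [||[z [Vz zq zN]]] := IH q V3 qV'.
- move=> z w zq wq zw; have := clq z w zq wq zw; rewrite A'.
  have [zu|_] := eqVneq z u; first by rewrite -zu zq in uq.
  by have [wu|_] := eqVneq w u; [rewrite -wu wq in uq|rewrite !orbF].
- rewrite !inE => /and3P[_ -> /forall_inP tadj]; left; rewrite qV /=.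
  apply/forall_inP => z /tadj /forall_inP zadj; apply/forall_inP => w /zadj.
  by move/implyP => zw; apply/implyP => /zw; rewrite A' => ->.
- right; exists z; split=> //; first by rewrite EV inE Vz orbT.
  by move=> w /zN; rewrite A' => ->.
Qed.

Lemma alpha_excellent_perfect_3cover G : two_tree G -> 3 <= #|vset G| ->
  alpha_excellent G -> exists C, perfect_3cover G C.
Proof.
move=> Gt V3 exG; have [S [Q [indS _ pQ clQ cS]]] :=
  two_tree_clique_partition Gt (subxx (vset G)).
have QT : Q \subset triangles G.
  apply/subsetP => q qQ.
  have [//|[z [Vz zq zN]]] := clique_extension Gt V3 (partitionS pQ qQ) (clQ q qQ).
  have [S0 /andP[indS0 /eqP cS0] zS0] := exG z Vz.
  have [S0V S0adj] := independentP _ _ indS0.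
  have QS0 : #|Q| <= #|S0| by rewrite -cS cS0 independent_card_alpha.
  have meet1 : {in Q, forall q, #|S0 :&: q| <= 1}.
    by move=> p pQ'; apply: independent_meet_clique indS0 (clQ p pQ').
  (* [S0] has at least as many vertices as there are blocks and at most one in each, so it meets
     [q], and it does so in a neighbour of [z]. *)
  have /set0Pn[x /setIP[xS0 xq]] := partition_pigeonhole pQ QS0 S0V meet1 qQ.
  by have := S0adj z x zS0 xS0; rewrite zN.
by exists Q; apply/perfect_3cover_partitionP.
Qed.

(** * Red triangles form a perfect 3-cover *)

Lemma triangles_sub G' G : vset G' \subset vset G -> eset G' \subset eset G ->
  triangles G' \subset triangles G.
Proof.
move=> VV EE; apply/subsetP => t; rewrite !inE => /and3P[tV -> tadj] /=.
rewrite (subset_trans tV VV) /=; apply/forall_inP => x xt; apply/forall_inP => y yt.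
move/forall_inP/(_ x xt)/forall_inP/(_ y yt)/implyP: tadj => xy.
by apply/implyP => /xy; apply: (subsetP EE).
Qed.

Lemma triangles_del G U t : t \in triangles G -> [disjoint t & U] ->
  t \in triangles (del G U).
Proof.
rewrite !inE /= => /and3P[tV -> tadj] tU; rewrite subsetD tV tU /=.
apply/forall_inP => x xt; apply/forall_inP => y yt.
move/forall_inP/(_ x xt)/forall_inP/(_ y yt)/implyP: tadj => xy.
apply/implyP => /xy; rewrite adj_del => ->.
by rewrite !(disjointFr tU).
Qed.

Lemma labeled_E_perfect_3cover G R B : labeled_E G R B -> perfect_3cover G R.
Proof.
elim=> {G R B} [G a b c abc EV EE
  |G' R' B' G v1 v2 u1 u2 u3 _ IH v12 uq n1 n2 n3 EV EE
  |G' R' B' G v1 v2 v3 v4 u0 u1 u2 _ IH vR v34 uq n0 n1 n2 EV EE].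
- apply/perfect_3cover_partitionP; split.
    rewrite sub1set; apply: triangle_mem;
    by rewrite /adj EE !inE !eqxx ?orbT.
  rewrite EV; apply/and3P; split; rewrite ?trivIset1 //.
    by rewrite /cover big_set1.
  by rewrite !inE eq_sym; apply/set0Pn; exists a; rewrite !inE eqxx.
- case/perfect_3cover_partitionP: IH => R'T pR'.
  apply/perfect_3cover_partitionP; split.
    rewrite subUset sub1set; apply/andP; split.
      by apply: subset_trans R'T _; apply: triangles_sub; rewrite ?EV ?EE subsetUl.
    by apply: triangle_mem; rewrite adjC /adj EE !inE !eqxx ?orbT.
  rewrite EV setUC [X in partition _ X]setUC; apply: partitionU1 => //.
    by apply/set0Pn; exists u1; rewrite !inE eqxx.
  by rewrite disjoints_subset !subUset !sub1set !inE n1 n2 n3.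
- case/perfect_3cover_partitionP: IH => R'T pR'.
  have vT := subsetP R'T _ vR.
  have v1v : v1 \in [set v1; v2; v3] by rewrite !inE eqxx.
  have v2v : v2 \in [set v1; v2; v3] by rewrite !inE eqxx orbT.
  have v3v : v3 \in [set v1; v2; v3] by rewrite !inE eqxx orbT.
  have vV z : z \in [set v1; v2; v3] -> z \in vset G'.
    by move: vT; rewrite inE => /and3P[/subsetP + _ _]; apply.
  have [V1 V2 V3] := And3 (vV _ v1v) (vV _ v2v) (vV _ v3v).
  have [n13 n23] : v1 != v3 /\ v2 != v3.
    move: vT; rewrite inE => /and3P[_ + _]; rewrite setUC cardsU1 cards2 !inE.
    by rewrite !(eq_sym v3); case: (v1 == v3); case: (v2 == v3); case: (v1 == v2).
  have EsubE : eset G' \subset eset G by rewrite EE subsetUl.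
  have v12 : adj G v1 v2.
    apply: (subsetP EsubE); apply: (triangle_clique vT) => //.
    move: vT; rewrite inE => /and3P[_ + _]; rewrite setUC cardsU1 cards2 !inE.
    by case: (v1 == v2) => //; case: (_ || _).
  have nu u v : u \notin vset G' -> v \in vset G' -> (u == v) = false.
    by move=> uV' vV'; apply/negbTE; apply: contraNneq uV' => ->.
  apply/perfect_3cover_partitionP; split.
    rewrite !subUset !sub1set; apply/and3P; split.
    + apply: subset_trans (subD1set _ _) _.
      by apply: subset_trans R'T _; apply: triangles_sub; rewrite ?EV ?EE subsetUl.
    + by apply: triangle_mem => //; rewrite /adj EE !inE !eqxx ?orbT.
    + by apply: triangle_mem; rewrite adjC /adj EE !inE !eqxx ?orbT.
  rewrite setUC -(setUA [set [set u0; v1; v2]]).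
  (* The block [v1 v2 v3] disappears: [v1] and [v2] are covered again together with [u0], and [v3]
     together with [u1] and [u2]. *)
  have -> : vset G = [set u0; v1; v2] :|:
      ([set v3; u1; u2] :|: (vset G' :\: [set v1; v2; v3])).
    rewrite EV; apply/setP => z; rewrite !inE.
    have [->|_] := eqVneq z v1; first by rewrite V1 !orbT.
    have [->|_] := eqVneq z v2; first by rewrite V2 !orbT.
    have [->|_] := eqVneq z v3; first by rewrite V3 !orbT.
    by case: (z \in _); case: (z == u0); case: (z == u1); case: (z == u2).
  case/and3P: uq; rewrite !inE negb_or => /andP[n01 n02] n12 _.
  apply: partitionU1.
  + apply: partitionU1; first exact: partitionD1.
      by apply/set0Pn; exists v3; rewrite !inE eqxx.
    by rewrite disjoints_subset !subUset !sub1set !inE eqxx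
       (negbTE n1) (negbTE n2) !orbT !andbF.
  + by apply/set0Pn; exists u0; rewrite !inE eqxx.
  + rewrite disjoints_subset !subUset !sub1set !inE !eqxx !orbT /= (negbTE n0).
    rewrite (negbTE n13) (negbTE n23) (negbTE n01) (negbTE n02) (nu u0 v3) //.
    by rewrite !(eq_sym _ u1) !(eq_sym _ u2) !(nu u1) ?(nu u2) //= andbF.
Qed.

(** * Undoing the two operations *)

(** The trace that the first operation leaves, expressed inside [G]: the neighbour lists say that
    nothing else hangs on the new vertices. The roles of the letters are those of [labeled_E_O1]. *)
Definition O1_reducible G C := exists v1 v2 u1 u2 u3,
  [/\ uniq [:: u1; u2; u3; v1; v2],
      [/\ adj G v1 v2, adj G u1 v1, adj G u1 v2 & adj G u2 v2],
      [/\ adj G u1 u2, adj G u1 u3 & adj G u2 u3],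
      [/\ (forall y, adj G u1 y -> y \in [:: v1; v2; u2; u3]),
          (forall y, adj G u2 y -> y \in [:: v2; u1; u3]) &
          (forall y, adj G u3 y -> y \in [:: u1; u2])]
    & [set u1; u2; u3] \in C].

(** The analogous trace of the second operation. The vertex [v4] is only kept apart from the new
    vertices, so it may be [v1] or [v2]. *)
Definition O2_reducible G C := exists v1 v2 v3 v4 u0 u1 u2,
  [/\ uniq [:: u0; u1; u2; v1; v2; v3] /\ v4 \notin [:: u0; u1; u2],
      [/\ adj G v1 v2, adj G v1 v3, adj G v2 v3 & adj G v3 v4],
      [/\ adj G u0 v1, adj G u0 v2, adj G u1 v3, adj G u1 v4 &
          adj G u2 v3 /\ adj G u2 u1],
      [/\ (forall y, adj G u0 y -> y \in [:: v1; v2]),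
          (forall y, adj G u1 y -> y \in [:: v3; v4; u2]) &
          (forall y, adj G u2 y -> y \in [:: v3; u1])]
    & [set u0; v1; v2] \in C /\ [set v3; u1; u2] \in C].

Lemma two_tree_del0 G : two_tree G -> two_tree (del G set0).
Proof.
apply: two_tree_ext => /=; first by rewrite setD0.
by apply/setP => e; rewrite inE disjoint_sym disjoints_subset sub0set andbT.
Qed.

(** Vertices are deleted one at a time, and neighbours already in [U] no longer count. The vertices
    [p] and [q] only witness that at least three vertices are present before [u] goes. *)
Lemma two_tree_delU1 G U (u p q x y : T) : two_tree (del G U) ->
  uniq [:: u; p; q] -> [set u; p; q] \subset vset G :\: U ->
  (forall z, adj G u z -> [\/ z \in U, z = x | z = y]) ->
  two_tree (del G (u |: U)).
Proof.
move=> Gt upq sV Nu; rewrite setUC; apply: del_del.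
apply: (two_tree_del (x := x) (y := y)) Gt _ _ _ => /=.
- suff <- : #|[set u; p; q]| = 3 by apply: subset_leq_card.
  case/and3P: upq; rewrite !inE negb_or => /andP[up uq] pq _.
  by rewrite -setUA cardsU1 !inE negb_or up uq cards2 pq.
- by apply: (subsetP sV); rewrite !inE eqxx.
- by move=> z; rewrite adj_del => /and3P[/Nu[->|->|->]] //; auto.
Qed.

Lemma eset_delK G U (E : {set {set T}}) : E \subset eset G ->
  (forall x y, x \in U -> adj G x y -> [set x; y] \in E) ->
  eset G = eset (del G U) :|: E.
Proof.
move=> EG UE; apply/eqP; rewrite eqEsubset subUset EG andbT andbC.
apply/andP; split; first by apply/subsetP => e; rewrite inE => /andP[].
apply/subsetP => e eG; have [x [y e_xy]] := edge_ends eG; rewrite !inE eG /=.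
have [//|/pred0Pn[z /andP[/= ze zU]]] := boolP [disjoint e & U].
move: eG ze; rewrite e_xy -/(adj G x y) => xy /set2P[]zE.
  by rewrite UE -?zE ?orbT // zE.
by rewrite setUC UE ?orbT 1?adjC // -zE.
Qed.

Lemma O1_reduction G C : two_tree G -> perfect_3cover G C -> O1_reducible G C ->
  (forall G' C', two_tree G' -> perfect_3cover G' C' -> #|vset G'| < #|vset G| ->
     exists B, labeled_E G' C' B) ->
  exists B, labeled_E G C B.
Proof.
move=> Gt /perfect_3cover_partitionP[CT pC] [v1 [v2 [u1 [u2 [u3 []]]]]].
move=> uq [v12 u1v1 u1v2 u2v2] [u12 u13 u23] [N1 N2 N3] uC IH.
have [Vv1 Vv2 nv12] := adj_vset v12.
have [Vu1 Vu2 nu12] := adj_vset u12; have [_ Vu3 nu13] := adj_vset u13.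
pose U := [set u1; u2; u3].
have UV : U \subset vset G by rewrite !subUset !sub1set Vu1 Vu2 Vu3.
move: uq; rewrite /= !inE !negb_or.
case/and5P => /and4P[a1 a2 a3 a4] /and3P[b1 b2 b3] /andP[c1 c2] d _.
have v1U : v1 \notin U by rewrite !inE !negb_or !(eq_sym v1) a3 b2 c1.
have v2U : v2 \notin U by rewrite !inE !negb_or !(eq_sym v2) a4 b3 c2.
have Gt' : two_tree (del G U).
  (* In the order [u3], [u2], [u1], each vertex has at most two neighbours left when it is
     deleted. *)
  have -> : U = u1 |: (u2 |: (u3 |: set0)) by rewrite setU0 setUA.
  apply: (two_tree_delU1 (p := v1) (q := v2) (x := v1) (y := v2)).
  - apply: (two_tree_delU1 (p := v1) (q := v2) (x := v2) (y := u1)).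
    + apply: (two_tree_delU1 (p := v1) (q := v2) (x := u1) (y := u2)).
      * exact: two_tree_del0.
      * by rewrite /= !inE !negb_or c1 c2 d.
      * by rewrite !subUset !sub1set !inE Vu3 Vv1 Vv2.
      * by move=> z /N3; rewrite !inE => /orP[]/eqP->; [constructor 2|constructor 3].
    + by rewrite /= !inE !negb_or b2 b3 d.
    + by rewrite !subUset !sub1set !inE !orbF Vu2 Vv1 Vv2 b1
        !(eq_sym _ u3) c1 c2.
    + move=> z /N2; rewrite !inE => /or3P[]/eqP->;
        [constructor 2|constructor 3|constructor 1] => //.
      by rewrite eqxx.
  - by rewrite /= !inE !negb_or a3 a4 d.
  - rewrite !subUset !sub1set !inE !orbF !negb_or Vu1 Vv1 Vv2.
    by rewrite !(eq_sym v1) !(eq_sym v2) a1 a2 b2 b3 c1 c2.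
  - by move=> z /N1; rewrite !inE => /or4P[]/eqP->;
      [constructor 2|constructor 3|constructor 1|constructor 1];
      rewrite ?eqxx ?orbT.
(* The deleted vertices form a block of the cover, which is simply dropped. *)
have [||B HB] := IH (del G U) (C :\ U) Gt'.
- apply/perfect_3cover_partitionP; split; last exact: partitionD1.
  apply/subsetP => t tCU; apply: triangles_del.
    by apply: (subsetP CT); move: tCU; rewrite inE => /andP[].
  have := partitionS (partitionD1 pC uC) tCU.
  by rewrite subsetD => /andP[].
- rewrite /= cardsD -subn_gt0 subKn ?subset_leq_card ?subsetIl //.
  by apply/card_gt0P; exists u1; rewrite !inE Vu1 eqxx.
exists (B :|: [set [set v1; v2; u1]; [set v2; u1; u2]]).
rewrite -(setD1K uC) setUC.
apply: (labeled_E_O1 HB) => //=.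
- by rewrite adj_del v12 v1U v2U.
- by rewrite !inE negb_or a1 a2 b1.
- by rewrite !inE eqxx.
- by rewrite !inE eqxx orbT.
- by rewrite !inE eqxx orbT.
- by rewrite -/U -{1}(setID (vset G) U) (setIidPr UV) setUC.
apply: eset_delK.
- by rewrite !subUset !sub1set -!/(adj G _ _) u1v1 u1v2 u2v2
  !(adjC _ u3) u13 u23 adjC u12.
- move=> x y /[!inE] /orP[/orP[]|]/eqP->.
  + by move/N1; rewrite !inE !eq_set2 => /or4P[]/eqP->; rewrite !eqxx ?orbT.
  + by move/N2; rewrite !inE !eq_set2 => /or3P[]/eqP->; rewrite !eqxx ?orbT.
  + by move/N3; rewrite !inE !eq_set2 => /orP[]/eqP->; rewrite !eqxx ?orbT.
Qed.

Lemma O2_reduction G C : two_tree G -> perfect_3cover G C -> O2_reducible G C ->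
  (forall G' C', two_tree G' -> perfect_3cover G' C' -> #|vset G'| < #|vset G| ->
     exists B, labeled_E G' C' B) ->
  exists B, labeled_E G C B.
Proof.
move=> Gt /perfect_3cover_partitionP[CT pC].
case=> [v1 [v2 [v3 [v4 [u0 [u1 [u2 [[uq]]]]]]]]].
rewrite /= !inE !negb_or => /and3P[n40 n41 n42].
move=> [v12 v13 v23 v34] [u0v1 u0v2 u1v3 u1v4 [u2v3 u21]] [N0 N1 N2] [t0C t1C] IH.
have [Vv1 Vv2 nv12] := adj_vset v12; have [_ Vv3 nv13] := adj_vset v13.
have [Vu0 _ _] := adj_vset u0v1; have [Vu2 Vu1 _] := adj_vset u21.
have nv23 := adj_neq v23.
pose U := [set u0; u1; u2]; pose V := [set v1; v2; v3].
pose t0 := [set u0; v1; v2]; pose t1 := [set v3; u1; u2].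
have UV : U \subset vset G by rewrite !subUset !sub1set Vu0 Vu1 Vu2.
move: uq; rewrite /= !inE !negb_or.
case/and5P => /and5P[a1 a2 a3 a4 a5] /and4P[b1 b2 b3 b4] /and3P[c1 c2 c3] _ _.
have v1U : v1 \notin U by rewrite !inE !negb_or !(eq_sym v1) a3 b2 c1.
have v2U : v2 \notin U by rewrite !inE !negb_or !(eq_sym v2) a4 b3 c2.
have v3U : v3 \notin U by rewrite !inE !negb_or !(eq_sym v3) a5 b4 c3.
have v4U : v4 \notin U by rewrite !inE !negb_or n40 n41.
have Gt' : two_tree (del G U).
  (* The order of deletion is [u0], [u2], [u1]. *)
  have -> : U = u1 |: (u2 |: (u0 |: set0)).
    by rewrite setU0 /U set3_rot setUA.
  apply: (two_tree_delU1 (p := v1) (q := v2) (x := v3) (y := v4)).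
  - apply: (two_tree_delU1 (p := v1) (q := v2) (x := v3) (y := u1)).
    + apply: (two_tree_delU1 (p := v1) (q := v2) (x := v1) (y := v2)).
      * exact: two_tree_del0.
      * by rewrite /= !inE !negb_or a3 a4 nv12.
      * by rewrite !subUset !sub1set !inE Vu0 Vv1 Vv2.
      * by move=> z /N0; rewrite !inE => /orP[]/eqP->; [constructor 2|constructor 3].
    + by rewrite /= !inE !negb_or c1 c2 nv12.
    + by rewrite !subUset !sub1set !inE !orbF Vu2 Vv1 Vv2 !(eq_sym _ u0) a2 a3 a4.
    + by move=> z /N2; rewrite !inE => /orP[]/eqP->; [constructor 2|constructor 3].
  - by rewrite /= !inE !negb_or b2 b3 nv12.
  - rewrite !subUset !sub1set !inE !orbF !negb_or Vu1 Vv1 Vv2.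
    by rewrite !(eq_sym v1) !(eq_sym v2) (eq_sym u1 u0) a1 a3 a4 b1 c1 c2.
  - by move=> z /N1; rewrite !inE => /or3P[]/eqP->;
      [constructor 2|constructor 3|constructor 1]; rewrite ?eqxx.
have t01 : t1 \in C :\ t0.
  rewrite in_setD1 t1C andbT; apply/eqP => /setP/(_ u1).
  by rewrite !inE eqxx (eq_sym u1 u0) (negbTE a1) (negbTE b2) (negbTE b3) orbT.
have pC1 := partitionD1 (partitionD1 pC t0C) t01.
(* [V] shares [v1] with the cover triangle [t0] but differs from it in [v3]. Hence adding [V] to the
   smaller cover and removing it again restores the remaining blocks of [C]. *)
have VC : V \notin C.
  apply/negP => VC; have tI := partition_trivIset pC.
  have E : V = t0.
    rewrite -(def_pblock tI VC (x := v1)) ?(def_pblock tI t0C (x := v1)) //;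
    by rewrite !inE eqxx ?orbT.
  move/setP/(_ v3): E; rewrite !inE eqxx orbT.
  by rewrite !(eq_sym v3) (negbTE a5) (negbTE nv13) (negbTE nv23).
(* The two blocks that meet [U] are replaced by the single triangle [v1 v2 v3] on their old
   vertices. *)
have [||B HB] := IH (del G U) (V |: ((C :\ t0) :\ t1)) Gt'.
- apply/perfect_3cover_partitionP; split.
    rewrite subUset sub1set; apply/andP; split.
      apply: triangles_del; first exact: triangle_mem.
      by rewrite disjoints_subset !subUset !sub1set !in_setC v1U v2U v3U.
    apply/subsetP => t tC; apply: triangles_del.
      by apply: (subsetP CT); move: tC; rewrite !inE => /and3P[].
    have := partitionS pC1 tC; rewrite !subsetD -andbA => /and3P[_ d0 d1].
    rewrite disjoint_sym disjoints_subset !subUset !sub1set !inE.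
    by rewrite (disjointFl d0) ?(disjointFl d1) // !inE eqxx ?orbT.
  suff -> : vset (del G U) = V :|: ((vset G :\: t0) :\: t1).
    apply: partitionU1 => //; first by apply/set0Pn; exists v1; rewrite !inE eqxx.
    by rewrite disjoints_subset !subUset !sub1set !inE !eqxx !orbT ?andbF.
  apply/setP => z; rewrite !inE.
  have [->|_] := eqVneq z v1; first by move: v1U; rewrite !inE => ->.
  have [->|_] := eqVneq z v2; first by move: v2U; rewrite !inE => ->.
  have [->|_] := eqVneq z v3; first by move: v3U; rewrite !inE => ->.
  by case: (z == u0); case: (z == u1); case: (z == u2).
- rewrite /= cardsD -subn_gt0 subKn ?subset_leq_card ?subsetIl //.
  by apply/card_gt0P; exists u1; rewrite !inE Vu1 eqxx orbT.
exists (B :|: [set V; [set v3; v4; u1]]).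
have -> : C = ((V |: ((C :\ t0) :\ t1)) :\ V) :|: [set t0; t1].
  rewrite setU1K; last by rewrite !inE (negbTE VC) !andbF.
  apply/setP => t; rewrite !inE.
  have [->|_] := eqVneq t t0; first by rewrite t0C !orbT.
  by have [->|_] := eqVneq t t1; [rewrite t1C !orbT|rewrite /= orbF].
apply: (labeled_E_O2 HB) => //=.
- by rewrite !inE eqxx.
- by rewrite adj_del v34 v3U.
- by rewrite !inE negb_or a1 a2 b1.
- by rewrite !inE eqxx.
- by rewrite !inE eqxx orbT.
- by rewrite !inE eqxx orbT.
- by rewrite -/U -{1}(setID (vset G) U) (setIidPr UV) setUC.
apply: eset_delK.
- by rewrite !subUset !sub1set -!/(adj G _ _) u0v1 u0v2 u1v3 u1v4 u2v3 u21.
- move=> x y /[!inE] /orP[/orP[]|]/eqP->.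
  + by move/N0; rewrite !inE !eq_set2 => /orP[]/eqP->; rewrite !eqxx ?orbT.
  + by move/N1; rewrite !inE !eq_set2 => /or3P[]/eqP->; rewrite !eqxx ?orbT.
  + by move/N2; rewrite !inE !eq_set2 => /orP[]/eqP->; rewrite !eqxx ?orbT.
Qed.

End TwoTrees.

(* [lia] chokes on the many membership facts in context, so drop them first. *)
Ltac rank_lia :=
  intros; repeat match goal with
  | H : ?P |- _ => lazymatch P with
    | is_true (leq _ _) => fail
    | is_true (_ && _) => fail
    | is_true (~~ _) => fail
    | @eq nat _ _ => fail
    | _ /\ _ => fail
    | _ => clear H
    end
  end; lia.

(** * Ranking the vertices by a construction *)

(** The two earlier neighbours are sorted by rank, which makes the later one, [q], the parent of
    [v]. With a construction rank these parents form a tree rooted at [b], containing all vertices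
    except [a]. *)
Definition attached (T : finType) (G : sgraph T) (r : T -> nat) (v p q : T) :=
  [/\ adj G v p, adj G v q, adj G p q, r p < r q < r v &
      forall y, adj G v y -> r y < r v -> y = p \/ y = q].

Definition construction_rank (T : finType) (G : sgraph T) (r : T -> nat) (a b : T) :=
  [/\ adj G a b, r a = 0 /\ r b = 1, {in vset G &, injective r} &
      forall v, v \in vset G ->
        [\/ v = a, v = b | exists p q, attached G r v p q]].

Lemma two_tree_construction_rank (T : finType) (G : sgraph T) : two_tree G ->
  exists r a b, construction_rank G r a b.
Proof.
(* Bounding ranks by the number of vertices makes that number a fresh, largest rank for the next
   vertex. *)
move=> Gt; suff [r [a [b [Hr _]]]] : exists r a b, construction_rank G r a b /\
    {in vset G, forall v, r v < #|vset G|} by exists r, a, b.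
elim: Gt => [{}G x y xy EV EE|G' {}G x y u _ IH xy uG' EV EE].
  pose r z : nat := z != x.
  have [rx ry] : r x = 0 /\ r y = 1 by rewrite /r eqxx eq_sym xy.
  exists r, x, y; split; last first.
    by move=> v _; rewrite EV cards2 xy /r; case: (v == x).
  split=> //; first by rewrite /adj EE set11.
    rewrite EV => z w /set2P[]-> /set2P[]-> //; rewrite rx ry //.
  by move=> v; rewrite EV => /set2P[]->; [constructor 1|constructor 2].
case: IH => r [a [b [[ab [ra rb] rinj rP] rb']]].
have A' := adj_add _ _ EE; have [Vx Vy nxy] := adj_vset xy.
have [Va Vb nab] := adj_vset ab.
pose r' z := if z == u then #|vset G'| else r z.
have r'u : r' u = #|vset G'| by rewrite /r' eqxx.
have r'E z : z \in vset G' -> r' z = r z.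
  by rewrite /r'; case: eqP => // -> /(negP uG').
have r'lt z : z \in vset G' -> r' z < #|vset G'| by move=> Vz; rewrite r'E ?rb'.
have cV : #|vset G| = #|vset G'|.+1 by rewrite EV cardsU1 uG'.
exists r', a, b; split; last first.
  move=> v; rewrite cV EV => /setU1P[->|/r'lt]; rewrite ?r'u //; rank_lia.
split.
- by rewrite A' ab.
- by rewrite !r'E.
- move=> z w; rewrite EV => /setU1P[->|Vz] /setU1P[->|Vw] //; rewrite ?r'u.
  + by move=> E; have := r'lt w Vw; rank_lia.
  + by move=> E; have := r'lt z Vz; rank_lia.
  + by rewrite !r'E //; apply: rinj.
move=> v; rewrite EV => /setU1P[->|Vv].
  constructor 3.
  have uN z : adj G u z -> z = x \/ z = y.
    rewrite A' eqxx /= => /or3P[/adj_vset[]|/orP[]/eqP|/andP[_ /orP[]/eqP E]];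
      first [by auto | by rewrite (negbTE uG') | by rewrite E ?Vx ?Vy in uG'].
  have att p q : [set p; q] = [set x; y] -> r p < r q -> attached G r' u p q.
    move=> pq rpq.
    have [ux uy] : adj G u x /\ adj G u y by rewrite !A' !eqxx ?orbT.
    have /set2P px : p \in [set x; y] by rewrite -pq set21.
    have /set2P qx : q \in [set x; y] by rewrite -pq set22.
    split.
    + by case: px => ->.
    + by case: qx => ->.
    + by rewrite /adj pq -/(adj G x y) A' xy.
    + have Vp : p \in vset G' by case: px => ->.
      have Vq : q \in vset G' by case: qx => ->.
      by rewrite r'u !r'E // rpq rb'.
    + move=> z /uN zN _; apply/set2P; rewrite pq; exact/set2P.
  (* The ranks of [x] and [y] decide which of them becomes the parent of [u]. *)
  case: (ltngtP (r x) (r y)) => [lt|lt|/(rinj _ _ Vx Vy) E].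
  - by exists x, y; apply: att.
  - by exists y, x; apply: att => //; rewrite setUC.
  - by rewrite E eqxx in nxy.
case: (rP v Vv) => [->|->|[p [q [vp vq pq /andP[rpq rqv] vN]]]];
  [by constructor 1|by constructor 2|constructor 3; exists p, q].
have [_ Vp _] := adj_vset vp; have [_ Vq _] := adj_vset vq.
split; rewrite ?A' ?vp ?vq ?pq ?r'E ?rpq //.
move=> z vz; have [_] := adj_vset vz; rewrite EV => /setU1P[->|Vz] _.
  by rewrite r'u; have := rb' v Vv; rank_lia.
rewrite r'E //; apply: vN; move: vz; rewrite A'.
have [E|_] := eqVneq v u; first by rewrite -E Vv in uG'.
by have [E|_] := eqVneq z u; [rewrite -E Vz in uG'|rewrite /= orbF].
Qed.

(** A search through the finite type takes the place of excluded middle, as [P] and [Q] are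
    arbitrary propositions. *)
Lemma finite_or_forall (T : finType) (P : Prop) (Q : T -> Prop) :
  (forall c, P \/ Q c) -> P \/ forall c, Q c.
Proof.
move=> PQ; suff [|H] : P \/ forall c, c \in enum T -> Q c; [by left| |].
  by right=> c; apply: H; rewrite mem_enum.
elim: (enum T) => [|c s [|IH]]; [by right|by left|].
have [|Qc] := PQ c; first by left.
by right=> d; rewrite inE => /orP[/eqP->|/IH].
Qed.

(** * What a perfect 3-cover allows below a vertex *)

Section CoverStructure.
Variables (T : finType) (G : sgraph T) (r : T -> nat) (a b : T).
Variable C : {set {set T}}.
Hypothesis rankG : construction_rank G r a b.
Hypothesis coverC : perfect_3cover G C.
Implicit Types (c l p q v w x y z : T).

Notation attached := (attached G r).

Lemma cover_share t t' x y : t \in C -> t' \in C -> x \in t -> x \in t' ->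
  y \in t -> y \in t'.
Proof.
case/perfect_3coverP: coverC => _ _ CU tC t'C xt xt'.
by rewrite (CU x t t').
Qed.

Definition pendant w p q := forall y, adj G w y -> y \in [:: p; q].

Lemma pendant_cover w p q : w \in vset G -> pendant w p q -> [set w; p; q] \in C.
Proof.
case/perfect_3coverP: coverC => CT CE _ Vw Nw; have [t tC wt] := CE w Vw.
have [y [z [tE wy wz yz]]] := triangle_at (subsetP CT t tC) wt.
have := adj_neq yz; move: tC; rewrite tE.
move: (Nw y wy) (Nw z wz); rewrite !inE.
case/orP=> /eqP->; case/orP=> /eqP->; rewrite ?eqxx // => tC _.
by rewrite setUAC.
Qed.

(* The only vertex hanging below [w] is the degree-two vertex [l], attached to
   the edge [w x]. *)
Definition stem w p q l x :=
  [/\ x = p \/ x = q, adj G w l /\ adj G l x, r w < r l,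
      (forall y, adj G w y -> y \in [:: p; q; l]) /\
      (forall y, adj G l y -> y \in [:: w; x])
    & [set l; w; x] \in C].

(** A boolean substitute for the existence of an [x] with [attached c x w], so that children can be
    searched for. The two agree when [0 < r w]; for [w = a] they differ, since [b] is then a [child]
    but is not [attached]. *)
Definition child c w := [&& adj G c w, r w < r c &
  [forall y, adj G c y && (r y < r c) ==> (r y <= r w)]].

Lemma attached_child c x w : attached c x w -> child c w.
Proof.
case=> cx cw xw /andP[rxw rwc] Nc; apply/and3P; split=> //.
by apply/forallP => y; apply/implyP => /andP[cy ryc];
   case: (Nc y cy ryc) => ->; rank_lia.
Qed.

Lemma child_attached c w : 0 < r w -> child c w -> exists x, attached c x w.
Proof.
case: rankG => ab [ra rb] _ rP rw /and3P[cw rwc /forallP max_w].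
have [Vc _ _] := adj_vset cw.
case: (rP c Vc) => [E|E|[p [q att]]]; try by rewrite E in rwc; rank_lia.
case: (att) => cp cq pq /andP[rpq rqc] Nc.
have := max_w q; rewrite cq rqc /= => rqw.
by case: (Nc w cw rwc) => E; [rewrite E in rqw; rank_lia|exists p; rewrite E].
Qed.

Lemma attached_vset c x w : attached c x w -> c \in vset G.
Proof. by case=> /adj_vset[]. Qed.

(** Cover triangles that share a vertex coincide, and [c] outranks both [w] and [x'], which leaves
    only [c = c']. The variants with stems below use the same collision. *)
Lemma cover_pendant_pendant w c x c' x' : attached c x w -> attached c' x' w ->
  pendant c x w -> pendant c' x' w -> c = c'.
Proof.
move=> att att' pc pc'.
have tC := pendant_cover (attached_vset att) pc.
have tC' := pendant_cover (attached_vset att') pc'.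
case: att att' => _ _ _ rc _ [_ _ _ rc' _].
have : c \in [set c'; x'; w].
  by apply: (cover_share (x := w)) tC tC' _ _ _; rewrite !inE eqxx ?orbT.
by rewrite !inE -orbA => /or3P[]/eqP E //; have := congr1 r E; rank_lia.
Qed.

Lemma cover_pendant_stem w c x c' x' l' z' : attached c x w -> attached c' x' w ->
  pendant c x w -> stem c' x' w l' z' -> z' \in [:: x; w] -> c = c'.
Proof.
move=> att att' pc [_ _ _ _ tC'] z'xw.
have tC := pendant_cover (attached_vset att) pc.
case: att att' => _ _ _ rc _ [_ _ _ rc' _].
have : c' \in [set c; x; w].
  apply: (cover_share (x := z')) tC' tC _ _ _; rewrite !inE ?eqxx ?orbT //.
  by rewrite -orbA; move: z'xw; rewrite !inE => ->; rewrite orbT.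
by rewrite !inE -orbA => /or3P[]/eqP E //; have := congr1 r E; rank_lia.
Qed.

(** As a child of [w], the vertex [l] would be adjacent to [w] and to the earlier [x']. But its
    neighbours are among [c] and [z], and [c] outranks [w], so [z] would have to be both. *)
Lemma stem_end_not_child w c x l z c' x' :
  attached c x w -> stem c x w l z -> attached c' x' w -> l <> c'.
Proof.
case=> _ _ _ rc _ [zE _ _ [_ Nl] _] [c'x' c'w _ rc' _] E.
have:= Nl x'; have := Nl w; rewrite E c'x' c'w => /(_ isT) + /(_ isT).
rewrite !inE => /orP[]/eqP E1 /orP[]/eqP E2;
  have := congr1 r E1; have := congr1 r E2; rank_lia.
Qed.

Lemma cover_stem_stem w c x l c' x' l' z : attached c x w -> attached c' x' w ->
  stem c x w l z -> stem c' x' w l' z -> c = c'.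
Proof.
move=> att att' st st'; have := stem_end_not_child att' st' att.
case: st st' att att' => [zE _ _ _ tC] [zE' _ _ _ tC'] [_ _ _ rc _] [_ _ _ rc' _].
have : c \in [set l'; c'; z].
  by apply: (cover_share (x := z)) tC tC' _ _ _; rewrite !inE eqxx ?orbT.
rewrite !inE -orbA => /or3P[]/eqP E //; first by rewrite E.
by have := congr1 r E; case: zE => ->; rank_lia.
Qed.

Ltac rank_neq := apply/eqP => Eq; have := congr1 r Eq; rank_lia.

Lemma stems_O2_reducible w c x l c' x' l' :
  attached c x w -> attached c' x' w -> c != c' ->
  stem c x w l w -> stem c' x' w l' x' -> O2_reducible G C.
Proof.
move=> att att' ncc' st st'.
have nl'c := stem_end_not_child att' st' att.
have nlc' := stem_end_not_child att st att'.
case: st st' att att' => [_ [cl lw] rl [Nc Nl] tC] [_ [cl' lx'] rl' [Nc' Nl'] tC'].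
move=> [cx cw xw rc _] [cx' cw' xw' rc' _].
have nl'l : l' <> l.
  move=> E; have := Nl' w; rewrite E lw !inE => /(_ isT) /orP[]/eqP E1;
  have := congr1 r E1; rank_lia.
(* Undoing the operation replaces the cover triangles [l' c' x'] and [w c l] by [c' x' w]. The
   vertex [c] was attached to the edge [w x], hence [x] in the role of [v4]. *)
exists c', x', w, x, l', c, l; split.
- split; rewrite /= !inE !negb_or.
    rewrite ncc'; repeat (apply/andP; split) => //; try (by apply/eqP); rank_neq.
  by repeat (apply/andP; split) => //; rank_neq.
- by rewrite cx' cw' xw' adjC xw.
- by rewrite adjC cl' lx' cw cx lw adjC cl.
- split=> // y.
    by move/Nc; rewrite !inE orbCA.
  by move/Nl; rewrite !inE orbC.
- by split=> //; rewrite set3_swap -set3_rot.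
Qed.

Definition node w p q := pendant w p q \/ exists l x, stem w p q l x.

(** Induction on the rank of [y]. If [w] is the parent of [y], then [y] is a child. Otherwise the
    parent [q] of [y] is an earlier-ranked later neighbour of [w], hence a child of [w] or the end
    of a stem. The end of a stem has no room for [y], and a child [q] with [y] below it is a stem
    ending in [y]. *)
Lemma later_neighbour w : 0 < r w ->
  (forall c x, attached c x w -> node c x w) ->
  forall y, adj G w y -> r w < r y ->
  (exists x, attached y x w) \/
  (exists c x, attached c x w /\ stem c x w y w).
Proof.
case: rankG => _ [ra rb] _ rP rw kids y.
have [n] := ubnP (r y); elim: n y => // n IH y le_n wy rwy.
have [_ Vy _] := adj_vset wy.
case: (rP y Vy) => [E|E|[p [q att]]]; try by rewrite E in rwy; rank_lia.
case: (att) => yp yq pq /andP[rpq rqy] Ny.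
case: (Ny w _ rwy) => [|E|E]; first by rewrite adjC.
  rewrite -E in pq rpq; have ryn : r q < n by rank_lia.
  have [[x attq]|[c [x [attc [_ _ rcq [_ Nq] _]]]]] := IH q ryn pq rpq.
    have [pend|[l [z st]]] := kids q x attq.
      case: attq => _ _ _ rq _.
      have := pend y; rewrite adjC yq !inE => /(_ isT) /orP[]/eqP E1;
      by have := congr1 r E1; rank_lia.
    case: (attq) (st) => _ _ _ rq _ [_ _ _ [Nq Nl] _].
    have /Nq : adj G q y by rewrite adjC.
    rewrite !inE => /or3P[]/eqP E1; try by have := congr1 r E1; rank_lia.
    right; exists q, x; split=> //; suff Ez : z = w by rewrite Ez -E1 in st.
    have := Nl w; rewrite -E1 adjC wy !inE => /(_ isT) /orP[]/eqP E2 //.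
    by have := congr1 r E2; rank_lia.
  have := Nq y; rewrite adjC yq !inE => /(_ isT) /orP[]/eqP E1;
  by have := congr1 r E1; rank_lia.
by left; exists p; rewrite E.
Qed.

(** Locates the block of [w] when it reaches below [w]. The delicate case is a child [y] with a stem
    [l]: [t] shares [y] with the block [l y z], so [w] lies in that block and must be [z]. *)
Lemma cover_below w y t : 0 < r w ->
  (forall c x, attached c x w -> node c x w) ->
  t \in C -> w \in t -> y \in t -> adj G w y -> r w < r y ->
  (exists c x, attached c x w /\ pendant c x w) \/
  (exists c x l, attached c x w /\ stem c x w l w).
Proof.
move=> rw kids tC wt yt wy rwy.
have [[x att]|[c [x [att st]]]] := later_neighbour rw kids wy rwy; last first.
  by right; exists c, x, y.
have [pend|[l [z st]]] := kids y x att; first by left; exists y, x.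
right; exists y, x, l; split=> //; suff Ez : z = w by rewrite Ez in st.
case: (att) (st) => _ _ _ ry _ [_ _ rl _ tC'].
have : w \in [set l; y; z].
  by apply: (cover_share (x := y)) tC tC' _ _ _; rewrite // !inE eqxx orbT.
rewrite !inE -orbA => /or3P[]/eqP E //; have := congr1 r E; rank_lia.
Qed.

Lemma earlier_or_later w p q y : attached w p q -> adj G w y ->
  [\/ y = p, y = q | r w < r y].
Proof.
case: rankG => _ _ rinj _ [_ _ _ _ Nw] wy.
have [Vw Vy nwy] := adj_vset wy.
case: (ltngtP (r y) (r w)) => [lt|lt|/(rinj _ _ Vy Vw) E].
- by case: (Nw y wy lt); [constructor 1|constructor 2].
- by constructor 3.
- by rewrite E eqxx in nwy.
Qed.

Lemma stem_O1_reducible w p q c x l : attached w p q -> attached c x w ->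
  stem c x w l w -> (forall y, adj G w y -> y \in [:: p; q; c; l]) ->
  O1_reducible G C.
Proof.
move=> [wp wq pq rw Nw] [cx cw xw rc _] [_ [cl lw] rl [Nc Nl] tC] Nw4.
(* [x] is one of the two earlier neighbours of [w], and [o] is the other. They play [v2] and [v1],
   while [w], [c], [l] are the three new vertices. *)
have [o [xo wo ro No]] : exists o, [/\ adj G o x, adj G w o, r o != r x /\ r o < r w
    & forall y, adj G w y -> y \in [:: o; x; c; l]].
  case: (Nw x) => [||->|->]; rewrite 1?adjC //; try rank_lia.
    exists q; rewrite adjC; split=> //; first by rank_lia.
    by move=> y /Nw4; rewrite !inE orbCA.
  by exists p; split=> //; rank_lia.
exists o, x, w, c, l; split.
- rewrite /= !inE !negb_or; repeat (apply/andP; split) => //; rank_neq.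
- by rewrite xo wo adjC xw cx.
- by rewrite adjC cw adjC lw cl.
- split=> // y.
  by move/Nl; rewrite !inE orbC.
- by rewrite set3_swap -set3_rot.
Qed.

(** If [x = x'], the blocks of [c] and [c'] would collide. So [x] and [x'] are the two earlier
    neighbours of [w], and [w x x'] is the triangle to be restored; here [v4] coincides with [v1],
    both being [w]. *)
Lemma pendant_stem_O2_reducible w p q c x c' x' l' : attached w p q ->
  attached c x w -> attached c' x' w -> c != c' ->
  pendant c x w -> stem c' x' w l' x' -> O2_reducible G C.
Proof.
move=> attw att att' ncc' pc st'.
have nl'c := stem_end_not_child att' st' att.
have nxx' : x' != x.
  apply: contra ncc' => /eqP E; apply/eqP.
  by apply: (cover_pendant_stem att att' pc st'); rewrite E mem_head.
have tC := pendant_cover (attached_vset att) pc.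
case: attw att att' st' => [wp wq pq rw Nw] [cx cw xw rc _] [cx' cw' xw' rc' _].
move=> [_ [cl' lx'] rl' [Nc' Nl'] tC'].
have xx' : adj G x x'.
  have xN : x = p \/ x = q by apply: Nw; rewrite 1?adjC //; rank_lia.
  have xN' : x' = p \/ x' = q by apply: Nw; rewrite 1?adjC //; rank_lia.
  by move: nxx'; case: xN => ->; case: xN' => ->; rewrite ?eqxx // adjC.
exists w, x, x', w, c, c', l'; split.
- split; rewrite /= !inE !negb_or.
    rewrite ncc' (eq_sym x) nxx'; repeat (apply/andP; split) => //;
    first [by apply/eqP=> E; apply: nl'c | rank_neq].
  by repeat (apply/andP; split) => //; rank_neq.
- by rewrite adjC xw adjC xw' xx'.
- by rewrite cw cx cx' cw' lx' adjC cl'.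
- split=> // y.
    by move/pc; rewrite !inE orbC.
  by move/Nl'; rewrite !inE orbC.
- by split; [rewrite setUAC|rewrite set3_swap -set3_rot].
Qed.

Lemma other_child_cases w c : 0 < r w ->
  (exists c' x', c != c' /\ attached c' x' w) \/
  (forall c' x', attached c' x' w -> c = c').
Proof.
move=> rw; case: (boolP [exists c', (c != c') && child c' w]).
  case/existsP=> c' /andP[ncc' /(child_attached rw)[x' att']].
  by left; exists c', x'.
move/existsPn => nex; right=> c' x' /attached_child cw'.
by have := nex c'; rewrite cw' andbT negbK => /eqP.
Qed.

(** Children first; then the block containing [w] decides. If it is [w p q], then [w] is pendant. If
    it contains a pendant child, [w] is a stem, or a second child permits undoing the second
    operation. If it contains a child and the end of its stem, one of the two operations can be
    undone. *)
Lemma node_or_reducible w p q : attached w p q ->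
  (O1_reducible G C \/ O2_reducible G C) \/ node w p q.
Proof.
(* The sum of all ranks bounds every single rank, so this measure drops from [w] to its children. *)
have [n] := ubnP (\sum_v r v - r w).
elim: n w p q => // n IH w p q le_n attw.
have [wp wq pq rw _] := attw; have Vw := attached_vset attw.
have rw0 : 0 < r w by rank_lia.
have [||kids] := @finite_or_forall _ (O1_reducible G C \/ O2_reducible G C)
  (fun c => forall x, attached c x w -> node c x w); [|by left|].
  move=> c; case: (boolP (child c w)) => [cw|ncw]; last first.
    by right=> x att; rewrite (attached_child att) in ncw.
  have [x att] := child_attached rw0 cw; have [_ _ _ rc _] := att.
  have r_sum : r c <= \sum_v r v by rewrite (bigD1 c) //= leq_addr.
  have [|//|Hc] := IH c x w _ att; [by rank_lia|by left|right=> x' att'].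
  suff -> : x' = x by [].
  have [cx' _ _ rc' _] := att'; have [_ _ _ _ Nc] := att.
  by case: (Nc x' cx') => [|//|E]; [rank_lia|rewrite E in rc'; rank_lia].
have {}kids c x : attached c x w -> node c x w by apply: kids.
have [CT CE _] := (perfect_3coverP G C).1 coverC.
have [t tC wt] := CE w Vw.
have [y [z [tE wy wz yz]]] := triangle_at (subsetP CT t tC) wt.
have [|[[c [x [att pc]]]|[c [x [l [att st]]]]]] : [set w; p; q] \in C \/
    (exists c x, attached c x w /\ pendant c x w) \/
    (exists c x l, attached c x w /\ stem c x w l w).
- have := cover_below rw0 kids tC wt.
  have yt : y \in t by rewrite tE !inE eqxx orbT.
  have zt : z \in t by rewrite tE !inE eqxx orbT.
  case: (earlier_or_later attw wy) => yE below; last by right; apply: below wy yE.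
    case: (earlier_or_later attw wz) => zE; last by right; apply: below wz zE.
      by have := adj_neq yz; rewrite yE zE eqxx.
    by left; rewrite -yE -zE -tE.
  case: (earlier_or_later attw wz) => zE; last by right; apply: below wz zE.
    by left; rewrite -yE -zE setUAC -tE.
  by have := adj_neq yz; rewrite yE zE eqxx.
- move=> wC; right; left=> v wv.
  (* The block of any child contains [w] or [x], hence would be [w p q], although the child outranks
     all three. *)
  have no_child c x : ~ attached c x w.
    move=> att; have [cx cw xw rc _] := att.
    have xwC : x \in [set w; p; q].
      have [_ _ _ _ Nw] := attw.
      by case: (Nw x); rewrite 1?adjC //; try rank_lia; move=> ->; rewrite !inE eqxx ?orbT.
    have wwC : w \in [set w; p; q] by rewrite !inE eqxx.
    have : c \in [set w; p; q].
      have [pc|[l [u [uE _ _ _ tC']]]] := kids c x att.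
        have tC' := pendant_cover (attached_vset att) pc.
        by apply: (cover_share (x := w)) tC' wC _ _ _; rewrite !inE eqxx ?orbT.
      have uwC : u \in [set w; p; q] by case: uE => ->.
      by apply: (cover_share (x := u)) tC' wC _ uwC _; rewrite !inE eqxx ?orbT.
    by rewrite !inE -orbA => /or3P[]/eqP E; have := congr1 r E; rank_lia.
  case: (earlier_or_later attw wv) => [->|->|rv]; rewrite ?inE ?eqxx ?orbT //.
  have [[x att]|[c [x [att _]]]] := later_neighbour rw0 kids wv rv;
  by have := no_child _ _ att.
- have [cx cw xw rc _] := att.
  have [[c' [x' [ncc' att']]]|uniq_c] := other_child_cases c rw0.
    left; right; have [pc'|[l' [z' st']]] := kids c' x' att'.
      by rewrite (cover_pendant_pendant att att' pc pc') eqxx in ncc'.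
    have [E _ _ _ _] := st'; case: E st' => -> st'.
      exact: (pendant_stem_O2_reducible attw att att' ncc' pc st').
    have E : c = c' by apply: (cover_pendant_stem att att' pc st'); rewrite !inE eqxx orbT.
    by rewrite E eqxx in ncc'.
  (* A sole pendant child makes [w] itself a stem whose end is [c]. *)
  right; right; exists c, x; split.
  + by have [_ _ _ _ Nw] := attw; apply: Nw; rewrite 1?adjC //; rank_lia.
  + by rewrite adjC cw cx.
  + by rank_lia.
  + split=> v; last by move/pc; rewrite !inE orbC.
    move=> wv; rewrite !inE.
    case: (earlier_or_later attw wv) => [->|->|rv]; rewrite ?eqxx ?orbT //.
    have [[x1 att1]|[c1 [x1 [att1 st1]]]] := later_neighbour rw0 kids wv rv.
      by rewrite (uniq_c _ _ att1) eqxx !orbT.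
    have E := uniq_c _ _ att1; have [_ [c1v _] rv1 _ _] := st1.
    rewrite -E in c1v rv1; have := pc v c1v.
    by rewrite !inE => /orP[]/eqP E1; have := congr1 r E1; rank_lia.
  + by rewrite setUAC; apply: pendant_cover (attached_vset att) pc.
- left; have [[c' [x' [ncc' att']]]|uniq_c] := other_child_cases c rw0.
    right; have [pc'|[l' [z' st']]] := kids c' x' att'.
      have E : c' = c by apply: (cover_pendant_stem att' att pc' st); rewrite !inE eqxx orbT.
      by rewrite E eqxx in ncc'.
    have [E _ _ _ _] := st'; case: E st' => -> st'.
      exact: (stems_O2_reducible att att' ncc' st st').
    by rewrite (cover_stem_stem att att' st st') eqxx in ncc'.
  left; apply: (stem_O1_reducible attw att st) => v wv.
  case: (earlier_or_later attw wv) => [->|->|rv]; rewrite !inE ?eqxx ?orbT //.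
  have [[x1 att1]|[c1 [x1 [att1 st1]]]] := later_neighbour rw0 kids wv rv.
    by rewrite (uniq_c _ _ att1) eqxx !orbT.
  have E := uniq_c _ _ att1; have [_ [c1v _] rv1 _ _] := st1.
  rewrite -E in c1v rv1; have [_ _ _ [Nc _] _] := st.
  have [_ _ _ rc _] := att; have := Nc v c1v.
  rewrite !inE => /or3P[]/eqP E1;
    first [by have := congr1 r E1; rank_lia|by rewrite E1 eqxx !orbT].
Qed.

Lemma construction_rank_ind (S : {set T}) : a \in S -> b \in S ->
  (forall v p q, attached v p q -> q \in S -> v \in S) -> vset G \subset S.
Proof.
case: rankG => _ _ _ rP aS bS step; apply/subsetP => v.
have [n] := ubnP (r v); elim: n v => // n IH v le_n Vv.
case: (rP v Vv) => [->|->|[p [q att]]] //; apply: (step v p q att).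
by have [_ /adj_vset[_ Vq _] _ rq _] := att; apply: IH => //; rank_lia.
Qed.

(** The analysis is repeated at the root [b], whose only earlier neighbour is [a]; every child of
    [b] is therefore attached to the edge [a b]. *)
Lemma reducible_or_triangle : (O1_reducible G C \/ O2_reducible G C) \/
  exists c, [/\ vset G = [set a; b; c], adj G a c, adj G b c & [set a; b; c] \in C].
Proof.
case: (rankG) => ab [ra rb] rinj rP; have [Va Vb nab] := adj_vset ab.
have rb0 : 0 < r b by rank_lia.
have [||nodes] := @finite_or_forall _ (O1_reducible G C \/ O2_reducible G C)
  (fun c => attached c a b -> node c a b); [|by left|].
  move=> c; case: (boolP (child c b)) => [cb|ncb]; last first.
    by right=> att; rewrite (attached_child att) in ncb.
  have [x att] := child_attached rb0 cb; have [cx _ _ rc _] := att.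
  have E : x = a by have [_ Vx _] := adj_vset cx; apply: rinj => //; rank_lia.
  by rewrite E in att; have [|Hc] := node_or_reducible att; [left|right].
have att_a c x : attached c x b -> x = a.
  by move=> [cx _ _ rc _]; have [_ Vx _] := adj_vset cx; apply: rinj => //; rank_lia.
have kids c x : attached c x b -> node c x b.
  by move=> att; have E := att_a c x att; rewrite E in att *; apply: nodes.
have [CT CE _] := (perfect_3coverP G C).1 coverC.
have [t tC bt] := CE b Vb.
have [y [z [tE b_y b_z yz]]] := triangle_at (subsetP CT t tC) bt.
(* Only [a] precedes [b], so the block of [b] contains a later vertex. *)
have [v [vt bv rv]] : exists v, [/\ v \in t, adj G b v & r b < r v].
  have late v : adj G b v -> v = a \/ r b < r v.
    move=> bv; have [_ Vv nbv] := adj_vset bv.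
    case: (posnP (r v)) => [rv|rv]; first by left; apply: rinj => //; rank_lia.
    right; case: (ltngtP (r b) (r v)) => [//|lt|/(rinj _ _ Vb Vv) E].
      by rank_lia.
    by rewrite E eqxx in nbv.
  have [yE|?] := late y b_y; last by exists y; rewrite tE !inE eqxx orbT.
  have [zE|?] := late z b_z; last by exists z; rewrite tE !inE eqxx orbT.
  by have := adj_neq yz; rewrite yE zE eqxx.
have [] := cover_below rb0 kids tC bt vt bv rv.
  case=> [c [x [att pc]]]; have Ex := att_a _ _ att; rewrite Ex in att pc.
  right; exists c; have [ca cb _ _ _] := att.
  have cC := pendant_cover (attached_vset att) pc.
  split; rewrite 1?adjC //; last by rewrite -set3_rot.
  apply/eqP; rewrite eqEsubset !subUset !sub1set Va Vb (attached_vset att) !andbT.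
  apply: construction_rank_ind => [||w p q attw]; rewrite !inE ?eqxx ?orbT //.
  have [wp wq _ rw _] := attw; rewrite -orbA => /or3P[]/eqP E.
  - by rewrite E in rw; rank_lia.
  - rewrite E in attw; have E' := att_a _ _ attw; rewrite E' in attw.
    suff -> : c = w by rewrite eqxx orbT.
    have [pw|[l [u st]]] := nodes _ attw.
      exact: cover_pendant_pendant att attw pc pw.
    apply: (cover_pendant_stem att attw pc st).
    by case: st => -[]-> *; rewrite !inE eqxx ?orbT.
  - by have := pc w; rewrite adjC -E wq !inE => /(_ isT) ->.
case=> [c [x [l [att st]]]]; have Ex := att_a _ _ att; rewrite Ex in att st.
left; right; have [[c' [x' [ncc' att']]]|uniq_c] := other_child_cases c rb0.
  have Ex' := att_a _ _ att'; rewrite Ex' in att'.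
  have [pc'|[l' [z' st']]] := nodes _ att'.
    have E : c' = c by apply: (cover_pendant_stem att' att pc' st); rewrite !inE eqxx orbT.
    by rewrite E eqxx in ncc'.
  have [E _ _ _ _] := st'; case: E st' => -> st'.
    exact: (stems_O2_reducible att att' ncc' st st').
  by rewrite (cover_stem_stem att att' st st') eqxx in ncc'.
have [_ _ rl [Nc Nl] lC] := st; have [ca cb _ rc _] := att.
(* With a sole child that is a stem, the graph has only these four vertices. The block [l c b] then
   leaves no triangle to cover [a], a contradiction. *)
have /subsetP V4 : vset G \subset [set a; b; c; l].
  apply: construction_rank_ind => [||w p q attw]; rewrite !inE ?eqxx ?orbT //.
  have [wp wq _ rw _] := attw; rewrite -!orbA => /or4P[]/eqP E.
  - by rewrite E in rw; rank_lia.
  - by rewrite E in attw; rewrite (uniq_c _ _ attw) eqxx !orbT.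
  - by have := Nc w; rewrite adjC -E wq !inE => /(_ isT)/or3P[]->; rewrite ?orbT.
  - by have := Nl w; rewrite adjC -E wq !inE => /(_ isT)/orP[]->; rewrite ?orbT.
have [s sC sa] := CE a Va.
have [u [u' [sE au _ _]]] := triangle_at (subsetP CT s sC) sa.
have [_ Vu nau] := adj_vset au.
have : a \in [set l; c; b].
  apply: (cover_share (x := u)) sC lC _ _ sa; first by rewrite sE !inE eqxx orbT.
  have := V4 u Vu; rewrite !inE eq_sym (negbTE nau) /=.
  by case: (u == b); case: (u == c); case: (u == l).
by rewrite !inE -orbA => /or3P[]/eqP E; have := congr1 r E; rank_lia.
Qed.

End CoverStructure.

(** * From covers to the family, and the equivalence *)

(** Prescribing [C] as the set of red triangles carries the induction: redoing the second operation
    requires the restored triangle [v1 v2 v3] to be red in the smaller graph. *)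
Lemma perfect_3cover_labeled_E (T : finType) (G : sgraph T) (C : {set {set T}}) :
  two_tree G -> perfect_3cover G C -> exists B, labeled_E G C B.
Proof.
have [n] := ubnP #|vset G|; elim: n G C => // n IH G C le_n Gt coverC.
have {}IH (G' : sgraph T) (C' : {set {set T}}) : two_tree G' -> perfect_3cover G' C' ->
    #|vset G'| < #|vset G| -> exists B, labeled_E G' C' B.
  by move=> Gt' coverC' lt; apply: IH => //; rank_lia.
have [r [a [b rankG]]] := two_tree_construction_rank Gt.
have [[red|red]|[c [EV ac bc abcC]]] := reducible_or_triangle rankG coverC.
- exact: O1_reduction red IH.
- exact: O2_reduction red IH.
have ab : adj G a b by case: rankG.
have [nab nac nbc] := And3 (adj_neq ab) (adj_neq ac) (adj_neq bc).
exists set0; have -> : C = [set [set a; b; c]].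
  case/perfect_3coverP: coverC => CT _ CU; apply/setP => t; rewrite inE.
  apply/idP/eqP => [tC|->//].
  have := subsetP CT t tC; rewrite inE EV => /and3P[/subsetP tV /eqP t3 _].
  have /card_gt0P[x xt] : 0 < #|t| by rewrite t3.
  exact: (CU x) (tV x xt).
apply: labeled_E_base => //.
  by rewrite /= !inE negb_or nab nac nbc.
apply: eset_ext => [e|x y].
  by rewrite !inE -orbA => /or3P[]/eqP->; [exists a, b|exists b, c|exists a, c].
apply/idP/idP => [xy|]; last first.
  by rewrite !inE -orbA => /or3P[]/eqP; rewrite /adj => ->.
have := adj_neq xy; have [Vx Vy _] := adj_vset xy.
move: Vx Vy; rewrite EV !inE -!orbA !eq_set2.
by case/or3P=> /eqP->; case/or3P=> /eqP->; rewrite !eqxx ?orbT.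
Qed.

Theorem theorem1 (T : finType) (G : sgraph T)
    (hG : two_tree G) (hn : 3 <= #|vset G|) :
  ((exists C : {set {set T}}, perfect_3cover G C) <-> in_family_E G) /\
  (in_family_E G <-> alpha_excellent G).
Proof.
have ab C : perfect_3cover G C -> in_family_E G.
  by move=> /(perfect_3cover_labeled_E hG)[B HB]; exists C, B.
have ba : in_family_E G -> exists C, perfect_3cover G C.
  by case=> R [B /labeled_E_perfect_3cover]; exists R.
split; split.
- by case=> C; apply: ab.
- exact: ba.
- by case/ba => C; apply: perfect_3cover_alpha_excellent.
- by case/(alpha_excellent_perfect_3cover hG hn) => C; apply: ab.
Qed.
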